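(* Let $\phi(x)=-\frac1{|x|}$, $x\in\mathbf{R}^{N}$, and consider the relativistic Kepler system in proper time $\tau$ $$\frac{dt}{d\tau}=\gamma,\quad\frac{dx}{d\tau}=u,\quad\frac{d\gamma}{d\tau}=-\nabla\phi(x)\cdot u,\quad\frac{du}{d\tau}=-\gamma\nabla\phi(x).$$ With $\mathbf{x}=(t,x^\top)^\top$, $\mathbf{M}=\operatorname{diag}(-1,\mathrm{I}_{N})$ and $\mathbf{A}(\mathbf{x})=(-\phi(x),0,\dots,0)^\top\in\mathbf{R}^{N+1}$, define the discrete Lagrangian $$\mathbb{L}^{\text{1st}}(\mathbf{x}_n,\mathbf{x}_{n+1},h)=\frac12\frac{(\mathbf{x}_{n+1}-\mathbf{x}_n)^\top\mathbf{M}(\mathbf{x}_{n+1}-\mathbf{x}_n)}{h^2}+\mathbf{A}^\top(\mathbf{x}_n)\frac{\mathbf{x}_{n+1}-\mathbf{x}_n}{h}.$$ Then the discrete Euler–Lagrange equation yields the variational integrator $$\frac{t_{n+1}-2t_n+t_{n-1}}{h^2}=-\frac{\phi(x_n)-\phi(x_{n-1})}{h},\qquad\frac{x_{n+1}-2x_n+x_{n-1}}{h^2}=-\frac{t_{n+1}-t_n}{h}\nabla\phi(x_n),$$ and this method is equivalent to the $K$-symplectic method $$\Phi_h=\phi_{H_{N}}^h\circ\cdots\circ\phi_{H_1}^h\circ\phi_{H_t}^h .$$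
   Context: The maps act on $(t,x,\gamma,u)$ with $x,u\in\mathbf{R}^N$, $\mathbf{e}_i$ the $i$-th standard basis vector of $\mathbf{R}^N$: $\phi_{H_t}^h:\ (t,x,\gamma,u)\mapsto(t+h\gamma,\ x,\ \gamma,\ u-h\gamma\nabla\phi(x))$; $\phi_{H_i}^h:\ (t,x,\gamma,u)\mapsto(t,\ x+hu_i\mathbf{e}_i,\ \gamma-[\phi(x+hu_i\mathbf{e}_i)-\phi(x)],\ u)$, $i=1,\dots,N$. These are the exact flows of the subsystems of the $K$-symplectic form of the system generated by $H_t=-\frac12\gamma^2$ and $H_i=\frac12u_i^2$. All points are assumed to avoid $x=0$. The discrete Euler–Lagrange equations are $\partial_1\mathbb{L}(\mathbf{x}_n,\mathbf{x}_{n+1},h)+\partial_2\mathbb{L}(\mathbf{x}_{n-1},\mathbf{x}_n,h)=0$. Equivalence means: with $\mathbf{v}_n=-h\frac{\partial\mathbb{L}(\mathbf{x}_n,\mathbf{x}_{n+1},h)}{\partial\mathbf{x}_n}-\mathbf{A}(\mathbf{x}_n)$ and $\mathbf{v}_{n+1}=h\frac{\partial\mathbb{L}(\mathbf{x}_n,\mathbf{x}_{n+1},h)}{\partial\mathbf{x}_{n+1}}-\mathbf{A}(\mathbf{x}_{n+1})$, and writing $\mathbf{v}_n=(-\gamma_n,u_n^\top)^\top$, these relations define precisely the one-step map $(t_n,x_n,\gamma_n,u_n)\mapsto(t_{n+1},x_{n+1},\gamma_{n+1},u_{n+1})=\Phi_h(t_n,x_n,\gamma_n,u_n)$. *)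

(* Defs.v *)
From HB Require Import structures.
From mathcomp Require Import all_boot all_order all_algebra.
From mathcomp Require Import all_classical all_reals all_analysis.

Set Implicit Arguments.
Unset Strict Implicit.
Unset Printing Implicit Defensive.

Import Order.TTheory GRing.Theory Num.Theory.
Import numFieldNormedType.Exports.

Local Open Scope ring_scope.

Section Kepler.
Context {R : realType}.

(* The norm `|x| that the library puts on matrices is the sup norm; it is used
   here only through the topology underlying 'D_v. *)
Definition enorm n (x : 'cV[R]_n) : R := Num.sqrt (\sum_i x i 0 ^+ 2).

Definition stdbasis n (i : 'I_n) : 'cV[R]_n := delta_mx i 0.

Definition grad n (f : 'cV[R]_n -> R) (x : 'cV[R]_n) : 'cV[R]_n :=
  \col_i 'D_(stdbasis i) f x.

Context {N : nat}.

Definition phi (x : 'cV[R]_N) : R := - (enorm x)^-1.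

(* Column vectors of R^{N+1} are split as a scalar (time) component followed by
   N spatial components. *)
Definition spacetime (t : R) (x : 'cV[R]_N) : 'cV[R]_(1 + N) := col_mx t%:M x.

Definition Mmx : 'M[R]_(1 + N) := block_mx (-1)%:M 0 0 1%:M.

Definition Apot (X : 'cV[R]_(1 + N)) : 'cV[R]_(1 + N) :=
  spacetime (- phi (dsubmx X)) 0.

Definition Lag1st (X Y : 'cV[R]_(1 + N)) (h : R) : R :=
  2^-1 * (((Y - X)^T *m Mmx *m (Y - X)) 0 0 / h ^+ 2)
  + ((Apot X)^T *m (h^-1 *: (Y - X))) 0 0.

Definition d1 (L : 'cV[R]_(1 + N) -> 'cV[R]_(1 + N) -> R -> R) X Y h :
  'cV[R]_(1 + N) := grad (fun Z => L Z Y h) X.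
Definition d2 (L : 'cV[R]_(1 + N) -> 'cV[R]_(1 + N) -> R -> R) X Y h :
  'cV[R]_(1 + N) := grad (fun Z => L X Z h) Y.

Definition discreteEL (L : 'cV[R]_(1 + N) -> 'cV[R]_(1 + N) -> R -> R)
    (h : R) (Xprev X Xnext : 'cV[R]_(1 + N)) : Prop :=
  d1 L X Xnext h + d2 L Xprev X h = 0.

(* A state is (t, x, gamma, u). *)
Definition state : Type := (R * 'cV[R]_N * R * 'cV[R]_N)%type.

Definition position (z : state) : 'cV[R]_N := let: (_, x, _, _) := z in x.

Definition flowHt (h : R) (z : state) : state :=
  let: (t, x, g, u) := z in (t + h * g, x, g, u - (h * g) *: grad phi x).

Definition flowH (i : 'I_N) (h : R) (z : state) : state :=
  let: (t, x, g, u) := z in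
  let x' := x + (h * u i 0) *: stdbasis i in
  (t, x', g - (phi x' - phi x), u).

(* flowH k o ... o flowH 1 o flowHt in the 1-based numbering of coordinates:
   the k-th intermediate stage of the composition method. *)
Definition stage (h : R) (k : nat) (z : state) : state :=
  foldl (fun z' i => flowH i h z') (flowHt h z) (take k (enum 'I_N)).

Definition Phi (h : R) (z : state) : state := stage h N z.

(* Discrete Legendre transforms at both ends of a step, with v = (- gamma, u):
   the potential A is subtracted to pass from canonical momenta
   to kinetic ones. *)
Definition momenta_rel (L : 'cV[R]_(1 + N) -> 'cV[R]_(1 + N) -> R -> R)
    (h : R) (z z' : state) : Prop :=
  let: (t, x, g, u) := z in
  let: (t', x', g', u') := z' in
  let X := spacetime t x in
  let X' := spacetime t' x' in
  spacetime (- g) u = - (h *: d1 L X X' h) - Apot X /\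
  spacetime (- g') u' = h *: d2 L X X' h - Apot X'.

End Kepler.

(* Main.v *)
Require Import Defs.
From mathcomp Require Import all_boot all_order all_algebra.
From mathcomp Require Import all_classical all_reals all_analysis.
From mathcomp Require Import ring.

(** Both halves of the theorem come from the two partial gradients of the
    discrete Lagrangian,
<<
      d1 = ( (t'-t)/h^2 + phi(x)/h,  -(x'-x)/h^2 - (t'-t)/h grad phi(x) ),
      d2 = ( -(t'-t)/h^2 - phi(x)/h,  (x'-x)/h^2 ),
>>
    which are [d1_Lag1st] and [d2_Lag1st].  Given these, the discrete
    Euler-Lagrange equation is the stated pair of difference equations up to
    signs.

    For the second half, solving the discrete Legendre relations
    ([momenta_rel_Lag1st]) gives t' - t = h g and x' - x = h U, with the kicked
    velocity U = u - h g grad phi(x), then u' = U, and the energy update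
    g' = g - (phi(x') - phi(x)).  The splitting method produces the same map:
    the time flow makes the kick, after which U is never modified, so the
    spatial flows add h U_i e_i one coordinate at a time and sum up to
    x + h U, while their updates of g telescope to phi(x') - phi(x)
    ([PhiE]).

    Every directional derivative is computed by restricting the function to a
    line ([is_derive_line]): the Lagrangian along a coordinate axis is a
    quadratic polynomial in the parameter, plus, in the spatial directions of
    the first argument, a multiple of phi, which is smooth away from the
    origin ([is_derive_phi]). *)

Set Implicit Arguments.
Unset Strict Implicit.
Unset Printing Implicit Defensive.

Import Order.TTheory GRing.Theory Num.Theory.
Import numFieldNormedType.Exports.

Local Open Scope ring_scope.

(** * Directional derivatives as derivatives along a line *)

(** The difference quotient only sees f on the line through a in the direction
    v; so derivatives at vectors reduce to calculus of one real variable. *)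
Lemma is_derive_line (R : realType) (V W : normedModType R) (f : V -> W)
    (a v : V) (df : W) :
  is_derive a v f df <-> is_derive (0 : R) 1 (fun s : R => f (a + s *: v)) df.
Proof.
have E : (fun k : R => k^-1 *: ((f \o shift a) (k *: v) - f a)) =
    (fun k : R => k^-1 *: (((fun s : R => f (a + s *: v)) \o shift 0) (k *: 1)
                            - f (a + 0 *: v))).
  by apply/funext => k; rewrite /= scale0r !addr0 [k *: 1]mulr1 [k *: v + a]addrC.
have [dE DE] : derivable f a v = derivable (fun s : R => f (a + s *: v)) 0 1
    /\ 'D_v f a = 'D_1 (fun s : R => f (a + s *: v)) (0 : R).
  by split; rewrite /derivable /derive E.
by split=> -[fd fE]; split; rewrite ?dE -?DE //; rewrite -?dE ?DE.
Qed.

Lemma is_derive_quadratic (R : realType) (a b c : R) :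
  is_derive (0 : R) 1 (fun s => a + b * s + c * s ^+ 2) b.
Proof.
have -> : (fun s => a + b * s + c * s ^+ 2) =
    cst a + b *: (id : R -> R) + c *: ((id : R -> R) ^+ 2) by [].
by apply: is_derive_eq; rewrite /GRing.scale /=; ring.
Qed.

Lemma is_derive_quadratic_add (R : realType) (a b c k dg : R) (g : R -> R) :
  is_derive (0 : R) 1 g dg ->
  is_derive (0 : R) 1 (fun s => a + b * s + c * s ^+ 2 + k * g s) (b + k * dg).
Proof.
move=> gd; exact: is_deriveD (is_derive_quadratic a b c) (is_deriveZ k gd).
Qed.

(** * The Kepler potential away from the origin *)

Section Euclidean.
Context {R : realType}.

Lemma sumsq_shift n (y : 'cV[R]_n) (i : 'I_n) (s : R) :
  \sum_j (y + s *: stdbasis i) j 0 ^+ 2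
    = \sum_j y j 0 ^+ 2 + 2 * y i 0 * s + s ^+ 2.
Proof.
rewrite (bigD1 i) //= [in RHS](bigD1 i) //= !mxE !eqxx /=.
rewrite (eq_bigr (fun j => y j 0 ^+ 2)); first by ring.
by move=> j ji; rewrite !mxE (negPf ji) mulr0 addr0.
Qed.

Lemma sumsq_gt0 n (x : 'cV[R]_n) : x != 0 -> 0 < \sum_i x i 0 ^+ 2.
Proof.
move=> x0; rewrite lt_neqAle sumr_ge0 ?andbT => [|i _]; last exact: sqr_ge0.
apply: contra x0; rewrite eq_sym psumr_eq0 => [/allP xE|i _]; last exact: sqr_ge0.
apply/eqP/colP => i; rewrite mxE; apply/eqP.
by rewrite -sqrf_eq0; apply: xE; rewrite mem_index_enum.
Qed.

(** Along a coordinate axis the squared norm is a quadratic polynomial, which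
    is positive at 0 because x != 0; hence - 1 / sqrt of it is derivable.
    Derivability is the whole point: the gradient is defined by limits that
    are meaningful, and linear in the function, only where they exist. *)
Lemma is_derive_phi n (x : 'cV[R]_n) (i : 'I_n) :
  x != 0 -> is_derive x (stdbasis i) (@phi R n) (grad (@phi R n) x i 0).
Proof.
move=> x0; rewrite mxE; apply: derivableP.
suff [df] : exists df, is_derive x (stdbasis i) (@phi R n) df by case.
pose S := \sum_j x j 0 ^+ 2.
have S0 : 0 < S := sumsq_gt0 x0.
pose q (s : R) := S + 2 * x i 0 * s + 1 * s ^+ 2.
have q0 : q 0 = S by rewrite /q /=; ring.
have qd : is_derive (0 : R) 1 q (2 * x i 0).
  exact: is_derive_quadratic.
have rd : is_derive (q 0) 1 Num.sqrt (2 * Num.sqrt (q 0))^-1.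
  by apply: is_derive1_sqrt; rewrite q0.
have sd := is_derive1_comp rd qd.
have s0 : (Num.sqrt \o q) 0 != 0 by rewrite /= q0 gt_eqF // sqrtr_gt0.
eexists; apply/is_derive_line.
have -> : (fun s : R => phi (x + s *: stdbasis i))
    = - (fun s => ((Num.sqrt \o q) s)^-1).
  apply/funext => s; rewrite /phi /enorm sumsq_shift /q /=.
  by congr (- (Num.sqrt _)^-1); rewrite /S; ring.
by apply: is_deriveN; apply: is_deriveV.
Qed.

End Euclidean.

(** * Gradients of the discrete Lagrangian *)

Section Lagrangian.
Context {R : realType} {N : nat}.
Implicit Types (t h c : R) (x u : 'cV[R]_N).

Lemma spacetimeD t1 t2 x1 x2 :
  spacetime t1 x1 + spacetime t2 x2 = spacetime (t1 + t2) (x1 + x2).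
Proof. by rewrite /spacetime add_col_mx raddfD. Qed.

Lemma spacetimeZ c t x : c *: spacetime t x = spacetime (c * t) (c *: x).
Proof. by rewrite /spacetime scale_col_mx scale_scalar_mx. Qed.

Lemma spacetimeN t x : - spacetime t x = spacetime (- t) (- x).
Proof. by rewrite -scaleN1r spacetimeZ mulN1r scaleN1r. Qed.

Lemma spacetime0 : spacetime 0 0 = 0 :> 'cV[R]_(1 + N).
Proof. by rewrite /spacetime raddf0 col_mx0. Qed.

Lemma spacetime_inj t1 t2 x1 x2 :
  spacetime t1 x1 = spacetime t2 x2 <-> t1 = t2 /\ x1 = x2.
Proof.
split=> [/eq_col_mx[/matrixP/(_ 0 0) tE xE]|[-> ->] //].
by move: tE; rewrite !mxE.
Qed.

Lemma stdbasis_time : stdbasis (lshift N ord0) = spacetime 1 0 :> 'cV[R]_(1 + N).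
Proof.
rewrite /stdbasis delta_mx_ushift /spacetime; congr col_mx.
by apply/matrixP => i j; rewrite !mxE !ord1.
Qed.

Lemma stdbasis_space (i : 'I_N) :
  stdbasis (rshift 1 i) = spacetime 0 (stdbasis i) :> 'cV[R]_(1 + N).
Proof. by rewrite /stdbasis delta_mx_dshift /spacetime raddf0. Qed.

Lemma Apot_spacetime t x : Apot (spacetime t x) = spacetime (- phi x) 0.
Proof. by rewrite /Apot /spacetime col_mxKd. Qed.

Lemma Lag1stE h t t' x x' :
  Lag1st (spacetime t x) (spacetime t' x') h
    = 2^-1 * ((\sum_j (x' - x) j 0 ^+ 2 - (t' - t) ^+ 2) / h ^+ 2)
      - phi x * ((t' - t) / h).
Proof.
rewrite /Lag1st Apot_spacetime !spacetimeN !spacetimeD spacetimeZ /Mmx /spacetime !tr_col_mx.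
rewrite mul_row_block !mul_row_col !mulmx0 addr0 add0r mulmx1 trmx0 mul0mx addr0.
rewrite !tr_scalar_mx -!scalar_mxM !mxE /= !mulr1n.
rewrite (eq_bigr (fun j => (x' - x) j 0 ^+ 2)); last first.
  by move=> j _; rewrite !mxE expr2.
by ring.
Qed.

(** Splits the N+1 coordinate directions into the time axis and the N spatial
    axes, so that gradients can be read off in the (t, x) notation. *)
Lemma grad_spacetime (f : 'cV[R]_(1 + N) -> R) (X : 'cV[R]_(1 + N))
    (a : R) (b : 'cV[R]_N) :
  'D_(spacetime 1 0) f X = a ->
  (forall i, 'D_(spacetime 0 (stdbasis i)) f X = b i 0) ->
  grad f X = spacetime a b.
Proof.
move=> fa fb; apply/colP => j; rewrite mxE.
case: (split_ordP j) => i ->; last by rewrite stdbasis_space fb col_mxEd.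
by rewrite (ord1 i) stdbasis_time fa col_mxEu !mxE eqxx mulr1n.
Qed.

(** The first argument enters through the kinetic term and through the point
    where the potential is evaluated; only the latter brings in grad phi, and
    it is where x != 0 matters. *)
Lemma d1_Lag1st h t t' x x' : h != 0 -> x != 0 ->
  d1 Lag1st (spacetime t x) (spacetime t' x') h
    = spacetime ((t' - t) / h ^+ 2 + phi x / h)
        (- ((h ^+ 2)^-1 *: (x' - x)) - ((t' - t) / h) *: grad phi x).
Proof.
move=> h0 x0; apply: grad_spacetime => [|i]; apply: derive_val;
  apply/is_derive_line.
  pose S := \sum_j (x' - x) j 0 ^+ 2.
  have -> : (fun s : R => Lag1st (spacetime t x + s *: spacetime 1 0)
                            (spacetime t' x') h) =
      (fun s => (2^-1 * ((S - (t' - t) ^+ 2) / h ^+ 2) - phi x * ((t' - t) / h))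
         + ((t' - t) / h ^+ 2 + phi x / h) * s + (- 2^-1 / h ^+ 2) * s ^+ 2).
    apply/funext => s; rewrite spacetimeZ spacetimeD scaler0 addr0 Lag1stE /S /=.
    by field.
  exact: is_derive_quadratic.
pose S := \sum_j (x' - x) j 0 ^+ 2.
have -> : (fun s : R => Lag1st (spacetime t x + s *: spacetime 0 (stdbasis i))
                          (spacetime t' x') h) =
    (fun s => 2^-1 * ((S - (t' - t) ^+ 2) / h ^+ 2)
       + (- ((h ^+ 2)^-1 * (x' - x) i 0)) * s + (2^-1 / h ^+ 2) * s ^+ 2
       + (- ((t' - t) / h)) * phi (x + s *: stdbasis i)).
  apply/funext => s; rewrite spacetimeZ spacetimeD mulr0 addr0 Lag1stE.
  have -> : x' - (x + s *: stdbasis i) = (x' - x) + (- s) *: stdbasis i.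
    by rewrite scaleNr opprD addrA.
  rewrite sumsq_shift -/S; by field.
have /is_derive_line phid := is_derive_phi i x0.
apply: (is_derive_eq (is_derive_quadratic_add _ _ _ _ phid)).
by rewrite !mxE; ring.
Qed.

(** The potential is frozen at the left endpoint x, so it contributes a term
    linear in t' and no force: this asymmetry is what makes the
    method explicit. *)
Lemma d2_Lag1st h t t' x x' : h != 0 ->
  d2 Lag1st (spacetime t x) (spacetime t' x') h
    = spacetime (- ((t' - t) / h ^+ 2) - phi x / h) ((h ^+ 2)^-1 *: (x' - x)).
Proof.
move=> h0; apply: grad_spacetime => [|i]; apply: derive_val; apply/is_derive_line.
  pose S := \sum_j (x' - x) j 0 ^+ 2.
  have -> : (fun s : R => Lag1st (spacetime t x)
                            (spacetime t' x' + s *: spacetime 1 0) h) =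
      (fun s => (2^-1 * ((S - (t' - t) ^+ 2) / h ^+ 2) - phi x * ((t' - t) / h))
         + (- ((t' - t) / h ^+ 2) - phi x / h) * s + (- 2^-1 / h ^+ 2) * s ^+ 2).
    apply/funext => s; rewrite spacetimeZ spacetimeD scaler0 addr0 Lag1stE /S /=.
    by field.
  exact: is_derive_quadratic.
pose S := \sum_j (x' - x) j 0 ^+ 2.
have -> : (fun s : R => Lag1st (spacetime t x)
                          (spacetime t' x' + s *: spacetime 0 (stdbasis i)) h) =
    (fun s => (2^-1 * ((S - (t' - t) ^+ 2) / h ^+ 2) - phi x * ((t' - t) / h))
       + ((h ^+ 2)^-1 * (x' - x) i 0) * s + (2^-1 / h ^+ 2) * s ^+ 2).
  apply/funext => s; rewrite spacetimeZ spacetimeD mulr0 addr0 Lag1stE.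
  by rewrite addrAC sumsq_shift -/S /=; field.
rewrite [in X in is_derive _ _ _ X]mxE; exact: is_derive_quadratic.
Qed.

(** * The one-step map *)

(** The relations are triangular: the time component of the first gives t',
    its spatial part then gives x', and the second relation returns g' and u'.
    The potential that A puts into the momenta cancels the phi(x) of [d1_Lag1st]
    at the left end, and leaves the increment of phi at the right end. *)
Lemma momenta_rel_Lag1st h t t' x x' g g' u u' : h != 0 -> x != 0 ->
  let U := u - (h * g) *: grad phi x in
  momenta_rel Lag1st h (t, x, g, u) (t', x', g', u') <->
  [/\ t' = t + h * g, x' = x + h *: U, g' = g - (phi x' - phi x) & u' = U].
Proof.
move=> h0 x0 U; rewrite /momenta_rel d1_Lag1st // d2_Lag1st // !Apot_spacetime.
rewrite !spacetimeZ !spacetimeN !spacetimeD !spacetime_inj !oppr0 !addr0.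
have -> : - (h * ((t' - t) / h ^+ 2 + phi x / h)) - - phi x
    = - ((t' - t) / h) by field.
have -> : h * (- ((t' - t) / h ^+ 2) - phi x / h) - - phi x'
    = - ((t' - t) / h) - (phi x - phi x') by field.
have -> : - (h *: (- ((h ^+ 2)^-1 *: (x' - x)) - ((t' - t) / h) *: grad phi x))
    = h^-1 *: (x' - x) + (t' - t) *: grad phi x.
  by apply/colP => i; rewrite !mxE; field.
have -> : h *: ((h ^+ 2)^-1 *: (x' - x)) = h^-1 *: (x' - x).
  by rewrite scalerA; congr (_ *: _); field.
split=> [[[gE uE] [g'E u'E]]|[-> -> -> ->]].
  have tE : t' - t = h * g by rewrite -[g]opprK gE; field.
  have UE : U = h^-1 *: (x' - x) by rewrite /U -tE uE addrK.
  split; last by rewrite u'E UE.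
  - by rewrite -tE addrC subrK.
  - by rewrite UE scalerA divff // scale1r addrC subrK.
  - by rewrite -[LHS]opprK g'E -gE; ring.
rewrite ![_ + _ - _]addrC !addKr scalerA mulVf // scale1r subrK mulrC mulKf //.
by split; split=> //; ring.
Qed.

(** The spatial flows leave u fixed, so the displacements add up, and the
    increments of phi over consecutive points telescope. *)
Lemma foldl_flowH h (s : seq 'I_N) t x g u :
  let x' := x + h *: \sum_(i <- s) u i 0 *: stdbasis i in
  foldl (fun z i => flowH i h z) (t, x, g, u) s
    = (t, x', g - (phi x' - phi x), u).
Proof.
elim: s x g => [|i s IHs] x g /=.
  by rewrite big_nil scaler0 addr0 subrr subr0.
rewrite IHs big_cons scalerDr scalerA addrA; congr (_, _, _, _).
by ring.
Qed.

Lemma PhiE h t x g u :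
  let U := u - (h * g) *: grad phi x in
  Phi h (t, x, g, u)
    = (t + h * g, x + h *: U, g - (phi (x + h *: U) - phi x), U).
Proof.
rewrite /Phi /stage take_oversize ?size_enum_ord //= foldl_flowH.
set U := u - _.
suff -> : \sum_(i <- enum 'I_N) U i 0 *: stdbasis i = U by [].
rewrite big_enum /= [RHS]matrix_sum_delta; apply: eq_bigr => i _.
by rewrite big_ord1.
Qed.

End Lagrangian.

Theorem theorem3p5 (R : realType) (N : nat) (h : R) (h_neq0 : h != 0) :
  (forall (tprev t tnext : R) (xprev x xnext : 'cV[R]_N),
     xprev != 0 -> x != 0 -> xnext != 0 ->
     discreteEL Lag1st h
       (spacetime tprev xprev) (spacetime t x) (spacetime tnext xnext)
     <->
     (tnext - 2 * t + tprev) / h ^+ 2 = - ((phi x - phi xprev) / h) /\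
     (h ^+ 2)^-1 *: (xnext - 2 *: x + xprev)
       = - (((tnext - t) / h) *: grad phi x))
  /\
  (forall z z' : @state R N,
     (forall k : nat, (k <= N)%N -> position (stage h k z) != 0) ->
     position z' != 0 ->
     momenta_rel Lag1st h z z' <-> z' = Phi h z).
Proof.
split=> [tprev t tnext xprev x xnext _ x0 _|[[[t x] g] u] [[[t' x'] g'] u']].
  rewrite /discreteEL d1_Lag1st // d2_Lag1st // spacetimeD -spacetime0 spacetime_inj.
  (* Each component of the equation is, up to sign, the difference of the two
     sides of the corresponding scheme. *)
  have -> : (tnext - t) / h ^+ 2 + phi x / h
      + (- ((t - tprev) / h ^+ 2) - phi xprev / h)
      = (tnext - 2 * t + tprev) / h ^+ 2 - - ((phi x - phi xprev) / h) by field.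
  have -> : - ((h ^+ 2)^-1 *: (xnext - x)) - ((tnext - t) / h) *: grad phi x
      + (h ^+ 2)^-1 *: (x - xprev)
      = - ((h ^+ 2)^-1 *: (xnext - 2 *: x + xprev)
           - - (((tnext - t) / h) *: grad phi x)).
    by apply/colP => i; rewrite !mxE; ring.
  split=> [[/subr0_eq tE /eqP]|[-> ->]]; last by rewrite !subrr oppr0.
  by rewrite oppr_eq0 subr_eq0 => /eqP.
move=> /(_ 0%N (leq0n _)) z0 _.
(* Stage 0 is the state after the time flow, which does not move x. *)
have x0 : x != 0 by move: z0; rewrite /stage take0.
rewrite PhiE momenta_rel_Lag1st //.
by split=> [[-> -> -> ->]|[-> -> -> ->]].
Qed.
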